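(* Let $M$ be a real manifold, $X$ a complete vector field on $M$ with flow $\phi$, and $\alpha\in\Omega^1(M)$ a $1$-form on $M$. Then the map $h\colon TM\to M$, $(x,v)\mapsto\phi_{\alpha_x(v)}(x)$, is an algebra over the tangent functor monad if and only if $\alpha$ is $X$-basic.
   Context: Manifolds are smooth, paracompact, Hausdorff and real, modelled on separable Banach spaces. A differential form $\omega$ is $X$-semibasic if $i_X\omega=0$, and $X$-basic if moreover $i_Xd\omega=0$, equivalently (given $i_X\omega=0$) $\mathcal L_X\omega=0$. An algebra over the tangent functor monad on $M$ is a smooth map $h\colon TM\to M$ with $h(x,0)=x$ for all $x\in M$ and $h\circ Th=h\circ\mu_M$, where $\mu_M\colon T^2M\to TM$, $\mu_M(\xi)=\tau_{TM}(\xi)+T\tau_M(\xi)$ with $\tau$ the tangent bundle projection; in charts, $h\big(h(x,v),h'(x,v)(\dot x,\dot v)\big)=h(x,v+\dot x)$. *)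

(* Defs.v *)
(* MathComp-Analysis; the reals are an arbitrary [R : realType]. *)
From HB Require Import structures.
From mathcomp Require Import all_boot all_order all_algebra.
From mathcomp Require Import all_classical all_reals all_analysis.

Set Implicit Arguments.
Unset Strict Implicit.
Unset Printing Implicit Defensive.

Import Order.TTheory GRing.Theory Num.Theory.
Import numFieldNormedType.Exports.

Local Open Scope classical_set_scope.
Local Open Scope ring_scope.

(* [f] is C^k on the open set [U] when it is Frechet differentiable on [U] and
   (x, v) |-> Df(x) v is C^(k-1) on [U * E].  For finite k this is slightly
   weaker than asking for continuous derivatives in operator norm (C^k here
   gives C^(k-1) there, and C^k there gives C^k here), so that [smooth_on] is
   the usual smoothness between Banach spaces. *)
Fixpoint Ck (R : realType) (k : nat) (E F : normedModType R)
    (U : set E) (f : E -> F) : Prop :=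
  if k is k'.+1 then
    (forall x, U x -> differentiable f x) /\
    @Ck R k' (E * E)%type F (U `*` setT) (fun p => 'd f (p.1) p.2)
  else forall x, U x -> {for x, continuous f}.

Definition smooth_on (R : realType) (E F : normedModType R)
  (U : set E) (f : E -> F) : Prop := forall k, Ck k U f.

Definition separable_banach (R : realType) (E : normedModType R) : Prop :=
  (forall G : set_system E, ProperFilter G -> cauchy G ->
     exists x : E, G --> x) /\
  exists2 S : set E, countable S & dense S.

(* A set with charts into normed spaces, the axioms being in [smooth_atlas].
   The functions are total and only meaningful on the expected domains:
   [chart i] on [dom i], [chart_inv i] on the image of [dom i].
   [chart_at x] selects a chart around [x]; it serves to represent the tangent
   space at [x] by a model space. *)
Record charted (R : realType) := Charted {
  pt :> Type;
  idx : Type;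
  model : idx -> normedModType R;
  dom : idx -> set pt;
  chart : forall i : idx, pt -> model i;
  chart_inv : forall i : idx, model i -> pt;
  chart_at : pt -> idx
}.
Arguments dom {R c} i.
Arguments chart {R c} i x.
Arguments chart_inv {R c} i y.
Arguments chart_at {R c} x.

Definition smooth_atlas (R : realType) (M : charted R) : Prop :=
  [/\ forall x : M, dom (chart_at x) x,
      forall (i : idx M) (x : M), dom i x -> chart_inv i (chart i x) = x,
      forall i j : idx M, open (chart i @` (@dom R M i `&` dom j))
    & forall i j : idx M,
        smooth_on (chart i @` (@dom R M i `&` dom j))
                  (fun y => chart j (chart_inv i y))].

(* The manifold topology: the coarsest one for which the chart domains are open
   and the charts continuous. *)
Definition mspace (R : realType) (M : charted R) : Type := pt M.

Section Topology.
Context (R : realType) (M : charted R).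

HB.instance Definition _ := gen_eqMixin (mspace M).
HB.instance Definition _ := gen_choiceMixin (mspace M).

Definition chart_open : set (set (mspace M)) :=
  [set O | exists (i : idx M) (V : set (model i)),
     open V /\ O = dom i `&` (chart i @^-1` V)].

HB.instance Definition _ :=
  @isSubBaseTopological.Build (mspace M) (set (mspace M)) chart_open id.

End Topology.

Definition paracompact (T : topologicalType) : Prop :=
  forall C : set (set T),
    (forall A, C A -> open A) -> \bigcup_(A in C) A = setT ->
  exists C' : set (set T),
    [/\ forall B, C' B -> open B /\ exists2 A, C A & B `<=` A,
        \bigcup_(B in C') B = setT
      & forall x : T, exists2 N, nbhs x N &
          finite_set [set B | C' B /\ B `&` N !=set0]].

Definition manifold (R : realType) (M : charted R) : Prop :=
  [/\ smooth_atlas M,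
      forall i : idx M, separable_banach (model i),
      hausdorff_space (mspace M)
    & paracompact (mspace M)].

Definition smooth_map (R : realType) (M N : charted R) (f : M -> N) : Prop :=
  forall (i : idx M) (j : idx N),
    let U := chart i @` (@dom R M i `&` f @^-1` dom j) in
    open U /\ smooth_on U (fun y => chart j (f (chart_inv i y))).

Definition normed_charted (R : realType) (E : normedModType R) : charted R :=
  @Charted R E unit (fun=> E) (fun=> setT) (fun=> id) (fun=> id) (fun=> tt).

Definition prod_charted (R : realType) (M N : charted R) : charted R :=
  @Charted R (M * N)%type (idx M * idx N)%type
    (fun ij => (model ij.1 * model ij.2)%type : normedModType R)
    (fun ij => dom ij.1 `*` dom ij.2)
    (fun ij p => (chart ij.1 p.1, chart ij.2 p.2))
    (fun ij q => (chart_inv ij.1 q.1, chart_inv ij.2 q.2))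
    (fun p => (chart_at p.1, chart_at p.2)).

(* The tangent space at [x], a tangent vector being given by its coordinate in
   the chart [chart_at x]. *)
Definition tangent_space (R : realType) (M : charted R) (x : M) :
  normedModType R := model (chart_at x).

Definition tangent (R : realType) (M : charted R) : charted R :=
  @Charted R {x : M & tangent_space x} (idx M)
    (fun i => (model i * model i)%type : normedModType R)
    (fun i p => dom i (projT1 p))
    (fun i p => let x := projT1 p in let c := chart_at x in
       (chart i x,
        'd (fun y => chart i (chart_inv c y)) (chart c x) (projT2 p)))
    (fun i q => let x := chart_inv i q.1 in
       existT _ x
         ('d (fun y => chart (chart_at x) (chart_inv i y)) (q.1) q.2))
    (fun p => chart_at (projT1 p)).

Definition tangent_vector (R : realType) (M : charted R) (x : M)
  (v : tangent_space x) : tangent M := existT _ x v.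

Definition tangent_map (R : realType) (M N : charted R) (f : M -> N) :
    tangent M -> tangent N :=
  fun p => let x := projT1 p in
    let c := chart_at x in let c' := chart_at (f x) in
    @tangent_vector R N (f x)
      ('d (fun y => chart c' (f (chart_inv c y))) (chart c x) (projT2 p)).

Definition tangent_proj (R : realType) (M : charted R) : tangent M -> M :=
  @projT1 M _.

(* mu_M(xi) = tau_TM(xi) + T tau_M(xi); both terms are tangent vectors at
   tau_M(tau_TM(xi)). *)
Definition tangent_mult (R : realType) (M : charted R)
    (xi : tangent (tangent M)) : tangent M :=
  let p : tangent M := tangent_proj xi in
  let q : tangent M := tangent_map (@tangent_proj R M) xi in
  @tangent_vector R M (tangent_proj p)
    (projT2 p + (projT2 q : tangent_space (tangent_proj p))).

Definition tangent_algebra (R : realType) (M : charted R)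
    (h : tangent M -> M) : Prop :=
  [/\ smooth_map h,
      forall x : M, h (tangent_vector (0 : tangent_space x)) = x
    & forall xi : tangent (tangent M),
        h (tangent_map h xi) = h (tangent_mult xi)].

Definition smooth_vector_field (R : realType) (M : charted R)
    (X : forall x : M, tangent_space x) : Prop :=
  @smooth_map R M (tangent M) (fun x => tangent_vector (X x)).

(* [phi] is the global flow of [X]: a smooth action of (R, +) whose orbits are
   the integral curves of [X].  [X] is complete exactly when it has one. *)
Definition global_flow (R : realType) (M : charted R)
    (X : forall x : M, tangent_space x) (phi : R -> M -> M) : Prop :=
  [/\ @smooth_map R (prod_charted (normed_charted R^o) M) M
        (fun p => phi p.1 p.2),
      forall x, phi 0 x = x,
      forall s t x, phi (s + t) x = phi s (phi t x)
    & forall (t : R) (x : M),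
        @tangent_map R (normed_charted R^o) M (fun s => phi s x)
          (@tangent_vector R (normed_charted R^o) t (1 : R^o))
        = tangent_vector (X (phi t x))].

(* A 1-form is a fibrewise linear smooth function on the tangent bundle. *)
Definition smooth_one_form (R : realType) (M : charted R)
    (alpha : forall x : M, {linear tangent_space x -> R^o}) : Prop :=
  @smooth_map R (tangent M) (normed_charted R^o)
    (fun p => alpha (projT1 p) (projT2 p)).

Section OneForms.
Context (R : realType) (M : charted R).
Variable alpha : forall x : M, {linear tangent_space x -> R^o}.

(* [alpha] read in the chart [i], at the point [y], on the vector [v]. *)
Definition local_form (i : idx M) (y v : model i) : R^o :=
  let p : tangent M := chart_inv (i : idx (tangent M)) (y, v) in
  alpha (projT1 p) (projT2 p).

(* d(alpha)_x(v, w) = (D_v alpha)(w) - (D_w alpha)(v), without factor 1/2. *)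
Definition ext_deriv (x : M) (v w : tangent_space x) : R :=
  let c := chart_at x in
  'd (fun y => local_form y w) (chart c x) v
  - 'd (fun y => local_form y v) (chart c x) w.

Definition semibasic (X : forall x : M, tangent_space x) : Prop :=
  forall x, alpha x (X x) = 0.

Definition basic (X : forall x : M, tangent_space x) : Prop :=
  semibasic X /\ forall (x : M) (w : tangent_space x), ext_deriv (X x) w = 0.

End OneForms.

(* Main.v *)
(* Put [F t (x, w) = (phi_t^* alpha)_x w].  For [xi] in [T(TM)] with base point
   [(x, v)], horizontal part [x'] and [t = alpha_x v],
     [T h xi = dalpha(xi) X(phi_t x) + T phi_t x'],
   so, [phi] being an action of [R], the algebra identity at [xi] says that
     [phi_c x = x]  with
     [c = dalpha(xi) alpha(X)(phi_t x) + F t (x, x') - alpha_x x'].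
   If [alpha] is basic then [F] is independent of [t] by Cartan's formula, and
   [c = 0].  Conversely, [c] can be scaled arbitrarily by scaling [xi], so at a
   point [x] which is not fixed by the flow [c] vanishes: vertical [xi] give
   [alpha(X) = 0], and then [F t (x, _) = alpha_x] for every [t] in the range of
   [alpha_x], which is [0] or [R].  When [alpha_x = 0], the same argument from
   [phi_t x], backwards in time, still gives [F t (x, _) = alpha_x] for all [t].
   Differentiating at [t = 0] yields [i_X dalpha = 0]; at a fixed point
   [X = 0]. *)
Require Import Defs.
From HB Require Import structures.
From mathcomp Require Import all_boot all_order all_algebra.
From mathcomp Require Import all_classical all_reals all_analysis.
Import Order.TTheory GRing.Theory Num.Theory.
Import numFieldNormedType.Exports.
Local Open Scope classical_set_scope.
Local Open Scope ring_scope.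

Set Implicit Arguments.
Unset Strict Implicit.
Unset Printing Implicit Defensive.

(** * Differentials of germs, linear maps and translates *)

(** A differential depends only on the germ at the point. Chart expressions agree with the intended
    formulas only near a point, so most differentials below pass through this. *)
Lemma near_eq_is_diff (R : realType) (E F : normedModType R) (f g df : E -> F)
    (x : E) :
  (\forall y \near x, f y = g y) -> is_diff x f df -> is_diff x g df.
Proof.
move=> fg [dfx vfx].
have fgx : f x = g x := nbhs_singleton fg.
have /diff_locallyP [cdf /eqaddoP edf] := dfx.
have gd : g \o shift x = cst (g x) + 'd f x +o_ 0 id.
  apply/eqaddoP => e e0; have := edf e e0; apply: filter_app.
  have : \forall h \near (0 : E), f (h + x) = g (h + x).
    by have := fg; rewrite (near_shift 0) subr0.
  apply: filter_app; near=> h => fgh; rewrite /= !fctE /= fgh.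
  by rewrite /cst /= fgx.
split.
  by apply/diff_locallyP; rewrite (diff_unique cdf gd).
by rewrite (diff_unique cdf gd).
Unshelve. all: by end_near. Qed.

Lemma is_diff_linear (R : realType) (E F : normedModType R) (f : E -> F)
    (x : E) : linear f -> continuous f -> is_diff x f f.
Proof.
move=> lf cf.
pose lM := GRing.isLinear.Build _ _ _ _ _ lf.
pose l : {linear E -> F} := HB.pack f lM.
by split; [exact: (@linear_differentiable _ _ _ l)
          |exact: (@diff_lin _ _ _ l)].
Qed.

Lemma is_diff_ex (R : realType) (E F : normedModType R) (f df : E -> F)
  (x : E) : is_diff x f df -> differentiable f x.
Proof. by case. Qed.

Lemma is_diffE (R : realType) (E F : normedModType R) (f df : E -> F)
  (x v : E) : is_diff x f df -> 'd f x v = df v.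
Proof. by case=> _ ->. Qed.

Lemma is_diff_is_derive (R : realType) (E F : normedModType R)
    (f df : E -> F) (x v : E) :
  is_diff x f df -> is_derive x v f (df v).
Proof.
by move=> [dfx <-]; split; [exact: diff_derivable|exact: deriveE].
Qed.

Lemma is_diff_fst (R : realType) (E F : normedModType R) (x : E * F) :
  is_diff x (@fst E F) (@fst E F).
Proof. by apply: is_diff_linear => // ?; apply: cvg_fst. Qed.

(** The two difference quotients are the same function of the increment. Combined with the flow law,
    this carries a derivative at time 0 to any time. *)
Lemma is_derive_translate (R : realType) (E : normedModType R) (f g : R -> E)
    (t : R) (df : E) :
  (forall s, f (s + t) = g s) -> is_derive (0 : R) 1 g df ->
  is_derive t (1 : R) f df.
Proof.
move=> fg [ex <-].
have E0 : (fun h : R => h^-1 *: ((f \o shift t) (h *: (1 : R)) - f t)) =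
    (fun h : R => h^-1 *: ((g \o shift 0) (h *: (1 : R)) - g 0)).
  by apply/funext => h; rewrite /= -!fg addr0 add0r.
by split; rewrite /derivable /derive E0.
Qed.

Lemma open_setX (T S : topologicalType) (A : set T) (B : set S) :
  open A -> open B -> open (A `*` B).
Proof.
move=> oA oB; rewrite openE => -[x y] [/= Ax By].
by exists (A, B) => //=; split; exact: open_nbhs_nbhs.
Qed.

(** * Calculus of [Ck] *)

Section Ck.
Context {R : realType}.
Implicit Types E F G : normedModType R.

Lemma Ck_sub k E F (U V : set E) (f : E -> F) :
  U `<=` V -> Ck k V f -> Ck k U f.
Proof.
elim: k E F U V f => [|k IH] E F U V f UV /=; first by move=> c x /UV /c.
move=> [d c]; split; first by move=> x /UV /d.
by apply: IH c => p [/= /UV ? _].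
Qed.

Lemma Ck_local k E F (U : set E) (f : E -> F) :
  (forall x, U x -> exists V, [/\ open V, V x & Ck k V f]) -> Ck k U f.
Proof.
elim: k E F U f => [|k IH] E F U f /= H.
  by move=> x /H [V [_ Vx]]; apply.
split; first by move=> x /H [V [_ Vx [d _]]]; apply: d.
apply: IH => -[x v] [/= /H [V [oV Vx [_ c]]] _].
exists (V `*` setT); split => //=.
exact: open_setX oV openT.
Qed.

(** Openness of [U] turns agreement on [U] into agreement of germs, hence of differentials; [U * E]
    is again open for the induction. *)
Lemma eq_Ck k E F (U : set E) (f g : E -> F) :
  open U -> (forall x, U x -> f x = g x) -> Ck k U f -> Ck k U g.
Proof.
elim: k E F U f g => [|k IH] E F U f g oU fg /=.
  move=> c x Ux; have : f @ x --> f x := c x Ux.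
  rewrite /prop_for /continuous_at -fg //.
  apply: cvg_trans; apply: near_eq_cvg.
  near=> y; apply: fg; near: y; exact: open_nbhs_nbhs.
have nfg x : U x -> \forall y \near x, f y = g y.
  by move=> Ux; near=> y; apply: fg; near: y; exact: open_nbhs_nbhs.
move=> [d c]; split.
  move=> x Ux.
  by have [] := near_eq_is_diff (nfg x Ux) (differentiableP (d x Ux)).
apply: IH c; first exact: open_setX oU openT.
move=> [x v] [/= Ux _].
exact/esym/(is_diffE _ (near_eq_is_diff (nfg x Ux) (differentiableP (d x Ux)))).
Unshelve. all: by end_near. Qed.

Lemma CkS_differentiable k E F (U : set E) (f : E -> F) (x : E) :
  Ck k.+1 U f -> U x -> differentiable f x.
Proof. by move=> [d _] /d. Qed.

Lemma Ck_pred k E F (U : set E) (f : E -> F) : Ck k.+1 U f -> Ck k U f.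
Proof.
elim: k E F U f => [|k IH] E F U f.
  by move=> [d _] x /d; exact: differentiable_continuous.
by move=> [d c]; split => //; apply: IH.
Qed.

Lemma Ck_linear k E F (U : set E) (f : E -> F) :
  linear f -> continuous f -> Ck k U f.
Proof.
elim: k E F U f => [|k IH] E F U f lf cf /=; first by move=> x _; exact: cf.
split; first by move=> x _; exact: is_diff_ex (is_diff_linear x lf cf).
have -> : (fun p : E * E => 'd f (p.1) p.2) = fun p => f p.2.
  by apply/funext => p; exact: (is_diffE p.2 (is_diff_linear p.1 lf cf)).
apply: IH; first by move=> a [x v] [y w] /=; rewrite lf.
by move=> p; apply: continuous_comp; [exact: cvg_snd|exact: cf].
Qed.

Lemma Ck_pair k E F G (U : set E) (f : E -> F) (g : E -> G) : open U ->
  Ck k U f -> Ck k U g -> Ck k U (fun x => (f x, g x)).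
Proof.
elim: k E F G U f g => [|k IH] E F G U f g oU.
  by move=> cf cg x Ux; apply: cvg_pair; [exact: cf|exact: cg].
move=> [df cf] [dg cg]; split.
  by move=> x Ux; apply: differentiable_pair; [exact: df|exact: dg].
have oUT : open (U `*` (@setT E)) by exact: open_setX oU openT.
apply: (eq_Ck oUT _ (IH _ _ _ _ _ _ oUT cf cg)).
by move=> [x v] [/= Ux _]; rewrite (diff_pair (df x Ux) (dg x Ux)).
Qed.

(** The derivative map of the composite is that of [g] after [(x, v) |-> (f x, Df(x) v)], again a
    composite, now on [U * E] and [V * F]. *)
Lemma Ck_comp k E F G (U : set E) (V : set F) (f : E -> F) (g : F -> G) :
  open U -> (forall x, U x -> V (f x)) ->
  Ck k U f -> Ck k V g -> Ck k U (g \o f).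
Proof.
elim: k E F G U V f g => [|k IH] E F G U V f g oU UV.
  by move=> cf cg x Ux; apply: continuous_comp; [exact: cf|exact/cg/UV].
move=> fk gk; have [df cf] := fk; have [dg cg] := gk; split.
  by move=> x Ux; apply: differentiable_comp; [exact: df|exact/dg/UV].
have oUT : open (U `*` (@setT E)) by exact: open_setX oU openT.
have fst_k : Ck k (U `*` setT) (f \o (@fst E E)).
  apply: (@IH _ _ _ _ U) => //; first by move=> [x v] [].
    by apply: Ck_linear => // ?; apply: cvg_fst.
  exact: Ck_pred.
apply: (@eq_Ck _ _ _ _
  ((fun q : F * F => 'd g (q.1) q.2) \o
   (fun p => (f p.1, 'd f (p.1) p.2)))) => //.
  by move=> [x v] [/= Ux _]; rewrite (diff_comp (df x Ux) (dg _ (UV x Ux))).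
apply: (@IH _ _ _ _ (V `*` setT)) => //; first by move=> [x v] [/= /UV].
exact: Ck_pair.
Qed.

(** Second derivatives are read off the differential of [(z, v) |-> Df(z) v] in the direction
    [(w, 0)]: freezing [v] is composition with [y |-> (y, v)]. *)
Lemma Ck2_slice E F (U : set E) (f : E -> F) (z v : E) :
    Ck 2 U f -> U z ->
  is_diff z (fun y => 'd f y v)
    (fun w => 'd (fun p : E * E => 'd f (p.1) p.2) (z, v) (w, 0)).
Proof.
move=> [_ [d2 _]] Uz.
have h1 : is_diff z (fun y : E => (y, v)) (fun w => (w, 0)).
  exact: is_diff_pair.
have h2 : is_diff ((fun y : E => (y, v)) z) (fun p : E * E => 'd f (p.1) p.2)
    ('d (fun p : E * E => 'd f (p.1) p.2) (z, v)).
  by apply: differentiableP; apply: d2.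
exact: (is_diff_comp h1 h2).
Qed.

End Ck.

(** * Symmetry of mixed second derivatives *)

Section Schwarz.
Context {R : realType} {E : normedModType R}.

Lemma near_parallelogram (x v w : E) (P : set E) : nbhs x P ->
  \forall h \near (0 : R)^'+, forall a b, 0 <= a <= h -> 0 <= b <= h ->
    P (a *: v + (b *: w + x)).
Proof.
move=> /nbhs_ballP [r /= r0 Pr].
(* The added 1 keeps the bound positive when [v] and [w] both vanish, so that [r] can be divided by
   it. *)
have M0 : 0 < `|v| + `|w| + 1 by rewrite ltr_pwDr // addr_ge0.
near=> h => a b /andP [a0 ah] /andP [b0 bh]; apply: Pr.
rewrite -ball_normE /= distrC addrA addrK.
apply: (le_lt_trans (ler_normD _ _));
  rewrite !normrZ (ger0_norm a0) (ger0_norm b0).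
have h0 : 0 < h by [].
apply: (@le_lt_trans _ _ (h * (`|v| + `|w| + 1))).
  rewrite !mulrDr mulr1 -[leLHS]addr0; apply: lerD; last exact: ltW.
  by apply: lerD; exact: ler_wpM2r.
rewrite -ltr_pdivlMr //; near: h; apply: nbhs_right_lt.
by rewrite divr_gt0.
Unshelve. all: by end_near. Qed.

Lemma is_derive_line (F : normedModType R) (f : E -> F) (df : F) (x v : E)
    (a : R) :
  is_derive (a *: v + x) v f df ->
  is_derive a (1 : R) (fun s : R => f (s *: v + x)) df.
Proof.
move=> [ex <-].
have E0 : (fun h : R => h^-1 *: (((fun s : R => f (s *: v + x)) \o shift a)
    (h *: 1) - f (a *: v + x))) =
  (fun h : R => h^-1 *: ((f \o shift (a *: v + x)) (h *: v) - f (a *: v + x))).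
  by apply/funext => h; rewrite /= [h%:A]mulr1 scalerDl addrA.
by split; rewrite /derivable /derive E0.
Qed.

(* The mean value theorem in each direction. *)
Lemma second_difference (g D S : E -> R) (U : set E) (x v w : E) (h : R) :
  (forall z, U z -> is_derive z v g (D z)) ->
  (forall z, U z -> is_derive z w D (S z)) -> 0 < h ->
  (forall a b, 0 <= a <= h -> 0 <= b <= h -> U (a *: v + (b *: w + x))) ->
  exists a b, [/\ 0 <= a <= h, 0 <= b <= h &
    g (h *: v + (h *: w + x)) - g (h *: v + x) - (g (h *: w + x) - g x)
    = S (a *: v + (b *: w + x)) * h * h].
Proof.
move=> gD DS h0 HU.
have hh : 0 <= h <= h by rewrite (ltW h0) lexx.
have h00 : 0 <= (0 : R) <= h by rewrite lexx ltW.
have HU0 a : 0 <= a <= h -> U (a *: v + x).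
  by move=> ah; have := HU a 0 ah h00; rewrite scale0r add0r.
(* [phi] is the increment of [g] along [h w], as a function of the position along [v]. A first mean
   value gives [a]; a second one, for [D] along [w], gives [b]. *)
pose phi a := g (a *: v + (h *: w + x)) - g (a *: v + x).
pose dphi a := D (a *: v + (h *: w + x)) - D (a *: v + x).
have phiP a : 0 <= a <= h -> is_derive a (1 : R) phi (dphi a).
  by move=> ah; apply: is_deriveB; apply/is_derive_line/gD;
    [exact: HU|exact: HU0].
have [||a] := MVT_segment (ltW h0) (f := phi) (df := dphi).
- by move=> a; rewrite in_itv /= => /andP [a0 ah]; apply: phiP; rewrite !ltW.
- apply: derivable_within_continuous => a; rewrite in_itv /= => ah.
  by have [] := phiP a ah.
rewrite in_itv /= => ah E1.
pose psi b := D (b *: w + (a *: v + x)).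
pose dpsi b := S (b *: w + (a *: v + x)).
have psiP b : 0 <= b <= h -> is_derive b (1 : R) psi (dpsi b).
  by move=> bh; apply/is_derive_line/DS; rewrite addrCA; exact: HU.
have [||b] := MVT_segment (ltW h0) (f := psi) (df := dpsi).
- by move=> b; rewrite in_itv /= => /andP [b0 bh]; apply: psiP; rewrite !ltW.
- apply: derivable_within_continuous => b; rewrite in_itv /= => bh.
  by have [] := psiP b bh.
rewrite in_itv /= => bh.
rewrite /psi /dpsi !scale0r !add0r !subr0 => E2.
move: E1; rewrite /phi /dphi !scale0r !add0r !subr0 => E1.
exists a, b; split => //.
by rewrite E1 [a *: v + (h *: w + x)]addrCA E2 [in RHS]addrCA.
Qed.

(** The second difference of [g] over the parallelogram on [h v] and [h w] is symmetric in [v] and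
    [w], and is [h * h] times a value of either mixed derivative near [x]. Continuity at [x] then
    bounds the gap by any [e]. *)
Lemma mixed_derivatives_eq (g Dv Dw Dvw Dwv : E -> R) (U : set E) (x v w : E) :
  nbhs x U ->
  (forall z, U z -> is_derive z v g (Dv z)) ->
  (forall z, U z -> is_derive z w g (Dw z)) ->
  (forall z, U z -> is_derive z w Dv (Dvw z)) ->
  (forall z, U z -> is_derive z v Dw (Dwv z)) ->
  {for x, continuous Dvw} -> {for x, continuous Dwv} -> Dvw x = Dwv x.
Proof.
move=> nU gv gw gvw gwv cvw cwv.
apply/eqP; rewrite -subr_eq0 -normr_eq0; apply/eqP/le_anti.
rewrite normr_ge0 andbT; apply/ler_addgt0Pl => e e0; rewrite addr0.
have e2 : 0 < e / 2 by rewrite divr_gt0.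
have /cvgrPdist_lt/(_ _ e2) n1 := cvw.
have /cvgrPdist_lt/(_ _ e2) n2 := cwv.
have H := near_parallelogram v w (filterI nU (filterI n1 n2)).
have [h [h0 Hh]] : exists h : R, 0 < h /\ forall a b, 0 <= a <= h ->
   0 <= b <= h -> [/\ U (a *: v + (b *: w + x)),
     `|Dvw x - Dvw (a *: v + (b *: w + x))| < e / 2
   & `|Dwv x - Dwv (a *: v + (b *: w + x))| < e / 2].
  have /filter_ex [h [h0 Hh]] : \forall h \near (0 : R)^'+, 0 < h /\
    (forall a b, 0 <= a <= h -> 0 <= b <= h ->
      (U `&` ([set y | `|Dvw x - Dvw y| < e / 2] `&`
         [set y | `|Dwv x - Dwv y| < e / 2])) (a *: v + (b *: w + x))).
    near=> h; split => //.
    by near: h; exact: H.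
  exists h; split => // a b ah bh.
  by have [p [q r]] := Hh a b ah bh.
have [|a [b [ah bh E1]]] := second_difference gv gvw h0 (x := x).
  by move=> a b ah bh; have [] := Hh a b ah bh.
have [|b' [a' [bh' ah' E2]]] := second_difference gw gwv h0 (x := x).
  by move=> b' a' bh' ah'; rewrite addrCA; have [] := Hh a' b' ah' bh'.
have E12 : Dvw (a *: v + (b *: w + x)) = Dwv (a' *: v + (b' *: w + x)).
  apply: (mulIf (lt0r_neq0 h0)); apply: (mulIf (lt0r_neq0 h0)).
  rewrite -E1 [in RHS]addrCA -E2 [h *: w + (h *: v + x)]addrCA.
  by rewrite !opprB addrACA [RHS]addrACA; congr (_ + _); rewrite addrC.
have [_ H1 _] := Hh a b ah bh; have [_ _ H2] := Hh a' b' ah' bh'.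
rewrite -(subrK (Dvw (a *: v + (b *: w + x))) (Dvw x)) -addrA.
apply: (le_trans (ler_normD _ _)); rewrite [leRHS]splitr; apply: lerD.
  exact: ltW.
by rewrite E12 distrC ltW.
Unshelve. all: by end_near. Qed.

(* The functional [l] makes the mean value theorem for real functions
   applicable. *)
Lemma schwarz (F : normedModType R) (l : {linear F -> R}) (f : E -> F)
    (U : set E) (x v w : E) :
  open U -> U x -> Ck 2 U f -> continuous l ->
  l ('d (fun p : E * E => 'd f (p.1) p.2) (x, v) (w, 0)) =
  l ('d (fun p : E * E => 'd f (p.1) p.2) (x, w) (v, 0)).
Proof.
move=> oU Ux f2 lc.
pose D2 v' w' z := 'd (fun p : E * E => 'd f (p.1) p.2) (z, v') (w', 0).
have dl y : is_diff y l l := is_diff_linear y (linearP l) lc.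
have D1P v' z : U z -> is_derive z v' (l \o f) (l ('d f z v')).
  move=> Uz; have df := differentiableP (CkS_differentiable f2 Uz).
  exact: is_diff_is_derive (is_diff_comp df (dl _)).
have D2P v' w' z : U z -> is_derive z w' (fun y => l ('d f y v'))
    (l (D2 v' w' z)).
  move=> Uz.
  exact: is_diff_is_derive w' (is_diff_comp (Ck2_slice v' f2 Uz) (dl _)).
have D2c v' w' : {for x, continuous (fun z => l (D2 v' w' z))}.
  apply: (@continuous_comp _ _ _ (D2 v' w') l); last exact: lc.
  have [_ [_ c]] := f2.
  apply: (@continuous_comp _ _ _ (fun z => ((z, v'), (w', 0)))
    (fun q : (E * E) * (E * E) =>
      'd (fun p : E * E => 'd f (p.1) p.2) (q.1) q.2)); last exact: c.
  have i : is_diff x (fun z : E => ((z, v'), (w', 0 : E)))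
      (fun z => ((z, 0), (0, 0))).
    exact: is_diff_pair (is_diff_pair (is_diff_id x) (is_diff_cst v' x))
      (is_diff_cst (w', 0 : E) x).
  exact: differentiable_continuous (is_diff_ex i).
exact: (mixed_derivatives_eq (open_nbhs_nbhs (conj oU Ux)) (D1P v) (D1P w)
  (D2P v w) (D2P w v) (D2c v w) (D2c w v)).
Qed.

End Schwarz.

(** * Cartan's formula in a chart *)

Section LocalCartan.
Context {R : realType} {E : normedModType R}.

(** Restricted to the fibre, [A] is linear and continuous, so it is its own differential at every
    [u]. *)
Lemma is_diff_fibre_linear (A : E * E -> R^o) (y u q : E) :
  (forall u, differentiable A (y, u)) -> linear (fun u => A (y, u)) ->
  'd A (y, u) (0, q) = A (y, q).
Proof.
move=> dA lA.
have i v : is_diff v (fun u : E => (y, u)) (fun u => (0, u)).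
  exact: is_diff_pair (is_diff_cst y v) (is_diff_id v).
have c v := is_diff_comp (i v) (differentiableP (dA v)).
have cA : continuous (fun u => A (y, u)).
  by move=> v; exact: differentiable_continuous (is_diff_ex (c v)).
by have := is_diffE q (is_diff_linear u lA cA); rewrite (is_diffE q (c u)).
Qed.

Lemma near_line (y w : E) (Q : set E) :
  nbhs y Q -> \forall s \near (0 : R), Q (s *: w + y).
Proof.
have c : {for (0 : R), continuous (fun s : R => s *: w + y)}.
  apply: differentiable_continuous.
  exact: is_diff_ex (is_diffD (is_diff_scalel (0 : R) w) (is_diff_cst y _)).
by move=> nQ; apply: c; rewrite /= scale0r add0r.
Qed.

(** [P] is a flow and [A] a 1-form in a chart. The time derivative of the pullback is [D_X A (w)]
    plus [A] of a mixed second derivative of [P]. Differentiating [alpha(X) = 0] along [w] shows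
    that [D_w A (X)] plus [A] of the mixed derivative in the other order is 0. Symmetry eliminates
    the second derivatives. *)
Lemma local_cartan (U : set (R^o * E)) (P : R^o * E -> E) (A : E * E -> R^o)
    (y w : E) :
  let X := 'd P (0, y) (1, 0) in
  open U -> U (0, y) -> Ck 2 U P ->
  (forall u, differentiable A (y, u)) -> linear (fun u => A (y, u)) ->
  (\forall z \near y, P (0, z) = z) ->
  (\forall z \near y, A (z, 'd P (0, z) (1, 0)) = 0) ->
  is_derive (0 : R) 1 (fun s : R => A (P (s, y), 'd P (s, y) (0, w)))
    ('d A (y, w) (X, 0) - 'd A (y, X) (w, 0)).
Proof.
move=> X oU Uy P2 dA lA P0 A0.
pose D2 v u := 'd (fun p : (R^o * E) * (R^o * E) => 'd P (p.1) p.2)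
  ((0, y), v) (u, 0).
have dP z : U z -> is_diff z P ('d P z).
  by move=> Uz; exact: differentiableP (CkS_differentiable P2 Uz).
have Py : P (0, y) = y := nbhs_singleton P0.
have i : is_diff y (fun z : E => (0 : R^o, z)) (fun u => (0, u)).
  exact: is_diff_pair (is_diff_cst (0 : R^o) y) (is_diff_id y).
(* At time 0 the map [P] is the identity near [y], hence so is its differential in space. *)
have Pw u : 'd P (0, y) (0, u) = u.
  have c := is_diff_comp i (dP _ Uy).
  by have := is_diffE u (near_eq_is_diff P0 c);
    rewrite (is_diffE u (is_diff_id y)).
have key v : is_diff (0 : R^o, y) (fun z => A (P z, 'd P z v))
    (fun u => 'd A (y, 'd P (0, y) v) ('d P (0, y) u, D2 v u)).
  have h := is_diff_pair (dP _ Uy) (Ck2_slice v P2 Uy).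
  have dA' : is_diff (P (0, y), 'd P (0, y) v) A ('d A (y, 'd P (0, y) v)).
    by rewrite Py; exact: differentiableP.
  exact: is_diff_comp h dA'.
have split v u q : 'd A (y, v) (u, q) = 'd A (y, v) (u, 0) + A (y, q).
  rewrite -(@is_diff_fibre_linear A y v q dA lA) -linearD.
  by congr ('d A (y, v) (_, _)); rewrite ?addr0 ?add0r.
(* Both derivatives are those of [z |-> A (P z, DP(z) v)] at [(0, y)] along [u]: [v = (0, w)] and
   [u = (1, 0)] for the pullback, the two exchanged for the semibasic identity. *)
have line (f : R -> R) (v u : R^o * E) (v0 u0 : E) :
    'd P (0, y) v = v0 -> 'd P (0, y) u = u0 ->
    (\forall s \near (0 : R),
      A (P (s *: u + (0, y)), 'd P (s *: u + (0, y)) v) = f s) ->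
    is_derive (0 : R) 1 f ('d A (y, v0) (u0, 0) + A (y, D2 v u)).
  move=> <- <- fE; apply: (near_eq_is_derive fE).
  apply: is_derive_eq (split _ _ _).
  apply: (is_derive_line (f := fun z => A (P z, 'd P z v))).
  by rewrite scale0r add0r; exact: is_diff_is_derive (key v).
have E1 : is_derive (0 : R) 1 (fun s : R => A (P (s, y), 'd P (s, y) (0, w)))
   ('d A (y, w) (X, 0) + A (y, D2 (0, w) (1, 0))).
  apply: line (Pw w) erefl _; near=> s.
  have -> // : s *: ((1, 0) : R^o * E) + (0, y) = (s, y).
  transitivity (s * 1 + 0 : R^o, s *: (0 : E) + y) => //.
  by rewrite mulr1 addr0 scaler0 add0r.
have E2 : 'd A (y, X) (w, 0) + A (y, D2 (1, 0) (0, w)) = 0.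
  have AP0 : nbhs y [set z | A (P (0, z), 'd P (0, z) (1, 0)) = 0].
    by apply: filterS2 P0 A0 => z /= ->.
  have c0 : \forall s \near (0 : R),
      A (P (0, s *: w + y), 'd P (0, s *: w + y) (1, 0)) = 0.
    exact: near_line AP0.
  have [|_ <-] := line (cst 0) (1, 0) (0, w) X w erefl (Pw w).
    near=> s.
    have -> : s *: ((0, w) : R^o * E) + (0, y) = (0, s *: w + y).
      transitivity (s * 0 + 0 : R^o, s *: w + y) => //.
      by rewrite mulr0 addr0.
    by near: s.
  exact: derive_cst.
have cA : continuous (fun u => A (y, u)).
  move=> v; apply: (@continuous_comp _ _ _ (fun u : E => (y, u)) A).
    by apply: differentiable_continuous;
      exact: is_diff_ex (is_diff_pair (is_diff_cst y v) (is_diff_id v)).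
  exact: differentiable_continuous (dA v).
(* [A (y, _)] is the continuous functional through which the mixed derivatives are compared. *)
pose lM := GRing.isLinear.Build _ _ _ _ _ lA.
pose l : {linear E -> R} := HB.pack (fun u => A (y, u)) lM.
have E3 : A (y, D2 (0, w) (1, 0)) = A (y, D2 (1, 0) (0, w)).
  exact: (schwarz (l := l) ((0, w) : R^o * E) ((1, 0) : R^o * E) oU Uy P2 cA).
have alg (a b q r : R) : b + r = 0 -> q = r -> a + q = a - b.
  by move=> br ->; rewrite -[r](addKr b) br addr0.
exact: is_derive_eq E1 (alg _ _ _ _ E2 E3).
Unshelve. all: by end_near. Qed.

End LocalCartan.

(** * Maps between charted spaces *)

Section Charts.
Context {R : realType}.
Implicit Types M N K : charted R.

(** The part of the atlas axioms on which the chain rule rests. It passes to products and tangent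
    bundles, hence holds for every space in play. *)
Definition chart_retract M : Prop :=
  (forall x : M, dom (chart_at x) x) /\
  forall (i : idx M) (x : M), dom i x -> chart_inv i (chart i x) = x.

Definition local_rep M N (i : idx M) (j : idx N) (f : M -> N) :
  model i -> model j :=
  fun y => chart j (f (chart_inv i y)).

Global Arguments local_rep {M N} i j f y.

Definition chart_deriv M N (i : idx M) (j : idx N) (f : M -> N) (x : M)
  (u : model i) : model j := 'd (local_rep i j f) (chart i x) u.

Global Arguments chart_deriv {M N} i j f x u.

(** The second condition stands in for continuity: near [x], [f] stays where the target chart can be
    inverted. All pairs of charts are quantified over because [chart_retract] says nothing about
    chart changes. *)
Definition mdiff M N (f : M -> N) (x : M) : Prop :=
  forall i j, dom i x -> dom j (f x) ->
    differentiable (local_rep i j f) (chart i x) /\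
    \forall y \near chart i x, dom j (f (chart_inv i y)).

Lemma mdiff_is_diff M N (f : M -> N) (x : M) i j :
  mdiff f x -> dom i x -> dom j (f x) ->
  is_diff (chart i x) (local_rep i j f) (chart_deriv i j f x).
Proof. by move=> fx ix jx; apply: differentiableP; case: (fx i j ix jx). Qed.

Lemma smooth_map_mdiff M N (f : M -> N) (x : M) :
  chart_retract M -> smooth_map f -> mdiff f x.
Proof.
move=> [_ rM] sf i j ix jx; have [oU /(_ 1%N) fk] := sf i j.
have Ux : (chart i @` (@dom R M i `&` f @^-1` dom j)) (chart i x) by exists x.
split; first exact: CkS_differentiable fk Ux.
apply: filterS (open_nbhs_nbhs (conj oU Ux)) => _ [z [iz jz] <-].
by rewrite rM.
Qed.

(** Inserting the chart [j] between [f] and [g] is harmless where [f] lands in [dom j], hence near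
    the point, which suffices for the chain rule. *)
Lemma is_diff_local_rep_comp M N K (f : M -> N) (g : N -> K) (x : M) i j k :
  chart_retract M -> chart_retract N -> mdiff f x -> mdiff g (f x) ->
  dom i x -> dom j (f x) -> dom k (g (f x)) ->
  is_diff (chart i x) (local_rep i k (g \o f))
    (chart_deriv j k g (f x) \o chart_deriv i j f x).
Proof.
move=> [_ rM] [_ rN] fx gx ix jx kx.
have df := mdiff_is_diff fx ix jx.
have lx : local_rep i j f (chart i x) = chart j (f x) by rewrite /local_rep rM.
have dg : is_diff (local_rep i j f (chart i x)) (local_rep j k g)
    (chart_deriv j k g (f x)).
  by rewrite lx; exact: mdiff_is_diff.
apply: near_eq_is_diff (is_diff_comp df dg).
have [_] := fx i j ix jx; apply: filterS => y jy /=.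
by rewrite /local_rep rN.
Qed.

Lemma mdiff_comp M N K (f : M -> N) (g : N -> K) (x : M) :
  chart_retract M -> chart_retract N -> mdiff f x -> mdiff g (f x) ->
  mdiff (g \o f) x.
Proof.
move=> hM hN fx gx i k ix kx.
have [dN rN] := hN; have [dM rM] := hM.
set j := chart_at (f x); have jx : dom j (f x) by exact: dN.
split; first exact: is_diff_ex (is_diff_local_rep_comp hM hN fx gx ix jx kx).
have [df nf] := fx i j ix jx; have [_ ng] := gx j k jx kx.
have lx : local_rep i j f (chart i x) = chart j (f x) by rewrite /local_rep rM.
rewrite -lx in ng.
apply: filterS2 nf (differentiable_continuous df ng) => y jy.
by rewrite /= /local_rep rN.
Qed.

Lemma chart_deriv_comp M N K (f : M -> N) (g : N -> K) (x : M) i j k u :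
  chart_retract M -> chart_retract N -> mdiff f x -> mdiff g (f x) ->
  dom i x -> dom j (f x) -> dom k (g (f x)) ->
  chart_deriv i k (g \o f) x u =
  chart_deriv j k g (f x) (chart_deriv i j f x u).
Proof.
by move=> hM hN fx gx ix jx kx;
  exact: is_diffE (is_diff_local_rep_comp _ _ _ _ _ _ _).
Qed.

Lemma mdiff_cst M N (y : N) (x : M) : mdiff (fun=> y) x.
Proof.
move=> i j ix jx; split; first exact: is_diff_ex (is_diff_cst (chart j y) _).
exact: filterE.
Qed.

Lemma chart_deriv_cst M N (y : N) (x : M) (i : idx M) (j : idx N) u :
  chart_deriv i j (fun=> y) x u = 0.
Proof. exact: is_diffE (is_diff_cst (chart j y) _). Qed.

Lemma is_diff_local_rep_pair M N K (f : M -> N) (g : M -> K) (x : M) i j k :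
  mdiff f x -> mdiff g x -> dom i x -> dom j (f x) -> dom k (g x) ->
  is_diff (chart i x)
    (@local_rep M (prod_charted N K) i (j, k) (fun x => (f x, g x)))
    (fun u => (chart_deriv i j f x u, chart_deriv i k g x u)).
Proof.
move=> fx gx ix jx kx.
exact: is_diff_pair (mdiff_is_diff fx ix jx) (mdiff_is_diff gx ix kx).
Qed.

Lemma mdiff_pair M N K (f : M -> N) (g : M -> K) (x : M) :
  mdiff f x -> mdiff g x ->
  @mdiff M (prod_charted N K) (fun x => (f x, g x)) x.
Proof.
move=> fx gx i [j k] ix [/= jx kx].
split; first exact: is_diff_ex (is_diff_local_rep_pair fx gx ix jx kx).
have [_ nf] := fx i j ix jx; have [_ ng] := gx i k ix kx.
by apply: filterS2 nf ng => y.
Qed.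

Lemma chart_deriv_pair M N K (f : M -> N) (g : M -> K) (x : M) i j k u :
  mdiff f x -> mdiff g x -> dom i x -> dom j (f x) -> dom k (g x) ->
  @chart_deriv M (prod_charted N K) i (j, k) (fun x => (f x, g x)) x u =
    (chart_deriv i j f x u, chart_deriv i k g x u).
Proof.
by move=> fx gx ix jx kx;
  exact: is_diffE (is_diff_local_rep_pair fx gx ix jx kx).
Qed.

Lemma chart_retract_normed (E : normedModType R) :
  chart_retract (normed_charted E).
Proof. by []. Qed.

Lemma chart_retract_prod M N :
  chart_retract M -> chart_retract N -> chart_retract (prod_charted M N).
Proof.
move=> [dM rM] [dN rN]; split;
  first by move=> [x y]; split; [exact: dM|exact: dN].
by move=> [i j] [x y] [/= ix jy]; rewrite rM // rN.
Qed.

Lemma mdiff_id_normed (E : normedModType R) (x : E) :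
  @mdiff (normed_charted E) (normed_charted E) id x.
Proof.
move=> i j _ _; split; first exact: is_diff_ex (is_diff_id (x : E)).
exact: filterE.
Qed.

Lemma chart_deriv_id_normed (E : normedModType R) (x u : E) :
  @chart_deriv (normed_charted E) (normed_charted E) tt tt id x u = u.
Proof. exact: is_diffE (is_diff_id x). Qed.

Lemma smooth_map_comp M N K (f : M -> N) (g : N -> K) :
  chart_retract M -> chart_retract N -> smooth_map f -> smooth_map g ->
  smooth_map (g \o f).
Proof.
move=> [dM rM] [dN rN] sf sg i k.
set W := chart i @` _.
pose U j := chart i @` (@dom R M i `&` f @^-1` dom j).
pose V j := chart j @` (@dom R N j `&` g @^-1` dom k).
(* [Z j] is the part of the chart [i] on which the intermediate chart [j] can be used. These open
   sets cover [W], and [Ck] is a local property. *)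
pose Z j := U j `&` local_rep i j f @^-1` V j.
have oZ j : open (Z j).
  have [oU /(_ 0%N) cf] := sf i j; have [oV _] := sg j k.
  rewrite openE => y [Uy Vy]; apply: filterI; first exact: open_nbhs_nbhs.
  by apply: (cf y Uy); exact: open_nbhs_nbhs.
have ZW j : Z j `<=` W.
  move=> _ [[x [ix jx] <-]]; rewrite /= /local_rep rM // => -[y [jy ky] yx].
  exists x => //; split => //=.
  by rewrite -(rN j (f x) jx) -yx rN.
have WZ y : W y -> exists j, Z j y.
  move=> [x [ix kx] <-]; exists (chart_at (f x)); split.
    by exists x => //; split => //; exact: dN.
  by exists (f x); [split => //; exact: dN|rewrite /local_rep rM].
split.
  rewrite openE => y /WZ [j Zy]; apply: filterS (@ZW j) _.
  exact: open_nbhs_nbhs.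
move=> n; apply: Ck_local => y /WZ [j Zy]; exists (Z j); split => //.
have [oU /(_ n) fk] := sf i j; have [oV /(_ n) gk] := sg j k.
have fkZ : Ck n (Z j) (local_rep i j f) by apply: Ck_sub fk => z [].
have ZV z : Z j z -> V j (local_rep i j f z) by case.
apply: eq_Ck (oZ j) _ (Ck_comp (oZ j) ZV fkZ gk) => _ [[x [ix jx] <-] _].
by rewrite /= /local_rep rM // rN.
Qed.

Lemma smooth_map_pair M N K (f : M -> N) (g : M -> K) :
  chart_retract M -> smooth_map f -> smooth_map g ->
  @smooth_map R M (prod_charted N K) (fun x => (f x, g x)).
Proof.
move=> [_ rM] sf sg i [j k].
have [oU fk] := sf i j; have [oV gk] := sg i k.
set U := chart i @` _ in oU fk; set V := chart i @` _ in oV gk.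
have -> : chart i @` (@dom R M i `&`
    (fun x => (f x, g x)) @^-1` @dom R (prod_charted N K) (j, k)) = U `&` V.
  apply/seteqP; split => [_ [x [ix [jx kx]] <-]|_ [[x [ix jx] <-] [z [iz kz]]]].
    by split; exists x.
  by move=> zx; exists x => //; split => //; split => //=;
    rewrite -(rM i x ix) -zx rM.
split; first exact: openI.
move=> n; apply: Ck_pair; first exact: openI.
  by apply: Ck_sub (fk n) => z [].
by apply: Ck_sub (gk n) => z [].
Qed.

End Charts.

(** * The tangent bundle *)

Section Tangent.
Context {R : realType} {M : charted R} (sM : smooth_atlas M).

Lemma smooth_atlas_retract : chart_retract M.
Proof. by case: sM. Qed.

Let rM := smooth_atlas_retract.

(** The chart-change clauses of [smooth_atlas] say exactly that the identity is smooth. *)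
Lemma smooth_map_id : @smooth_map R M M id.
Proof. by move=> i j; have [_ _ oM kM] := sM; split; [exact: oM|exact: kM]. Qed.

Lemma mdiff_id (x : M) : @mdiff R M M id x.
Proof. exact: smooth_map_mdiff rM smooth_map_id. Qed.

Lemma chart_deriv_id (x : M) (i : idx M) u :
  dom i x -> @chart_deriv _ M M i i id x u = u.
Proof.
move=> ix; have [oU _] := smooth_map_id i i.
apply: is_diffE (near_eq_is_diff _ (is_diff_id (chart i x))).
have Ux : (chart i @` (@dom R M i `&` dom i)) (chart i x) by exists x.
apply: filterS (open_nbhs_nbhs (conj oU Ux)) => _ [z [iz _] <-].
by rewrite /local_rep (rM.2 i z iz).
Qed.

(** Change of target chart is the chain rule with the identity as second map. It is used to leave
    the preferred charts in which tangent vectors are stored. *)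
Lemma chart_deriv_transition (N : charted R) (f : N -> M) (x : N) i j k u :
  chart_retract N -> mdiff f x -> dom i x -> dom j (f x) -> dom k (f x) ->
  @chart_deriv _ M M j k id (f x) (chart_deriv i j f x u) =
  chart_deriv i k f x u.
Proof.
move=> rN fx ix jx kx.
by rewrite -(chart_deriv_comp u rN rM fx (@mdiff_id (f x)) ix jx kx).
Qed.

Lemma tangent_chart (x : M) (v : tangent_space x) (i : idx M) :
  chart (i : idx (tangent M)) (tangent_vector v) =
  (chart i x, @chart_deriv _ M M (chart_at x) i id x v).
Proof. by []. Qed.

Lemma tangent_chart_at (x : M) (v : tangent_space x) :
  chart (chart_at x : idx (tangent M)) (tangent_vector v) =
  (chart (chart_at x) x, v).
Proof. by rewrite tangent_chart chart_deriv_id //; exact: rM.1. Qed.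

Lemma tangent_chart_inv (x : M) (i : idx M) (u : model i) : dom i x ->
  chart_inv (i : idx (tangent M)) (chart i x, u) =
  tangent_vector (@chart_deriv _ M M i (chart_at x) id x u).
Proof.
(* [chart_inv i (chart i x)] is only propositionally equal to [x], and the type
   of the tangent vector depends on it. *)
move=> ix; have H y : y = x -> existT (@tangent_space R M) y
    ('d (fun z => chart (chart_at y) (chart_inv i z)) (chart i x) u) =
    tangent_vector (@chart_deriv _ M M i (chart_at x) id x u) by move=> ->.
by apply: H; rewrite /= (rM.2 i x ix).
Qed.

(** The fibre coordinate is restored because the derivatives of a chart change and of its inverse
    compose to the derivative of the identity. *)
Lemma chart_retract_tangent : chart_retract (tangent M).
Proof.
split; first by move=> [x v]; exact: rM.1.
move=> i [x v] ix; rewrite [chart i _]tangent_chart.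
rewrite (tangent_chart_inv _ ix) /tangent_vector.
rewrite (chart_deriv_transition (f := id)) //;
  first by rewrite chart_deriv_id //; exact: rM.1.
- exact: mdiff_id.
- exact: rM.1.
- exact: rM.1.
Qed.

(** Chart domains of the tangent bundle are unions of whole fibres, and each fibre is mapped onto
    the model space; openness is thus inherited from [M]. *)
Lemma tangent_chart_image (i j : idx M) :
  chart (i : idx (tangent M)) @`
    (@dom R (tangent M) i `&` @tangent_proj R M @^-1` dom j) =
  (chart i @` (@dom R M i `&` dom j)) `*` setT.
Proof.
apply/seteqP; split => [_ [[x v] [ix jx] <-]|[y u] [/= [x [ix jx] <-] _]].
  by split => //; exists x.
exists (tangent_vector (@chart_deriv _ M M i (chart_at x) id x u)); first by [].
rewrite [LHS]tangent_chart; congr pair.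
rewrite (chart_deriv_transition (f := id)) ?chart_deriv_id //.
- exact: mdiff_id.
- exact: rM.1.
Qed.

Lemma smooth_map_tangent_proj : @smooth_map R (tangent M) M (@tangent_proj R M).
Proof.
move=> i j; have [oU fk] := smooth_map_id i j.
rewrite tangent_chart_image; split; first exact: open_setX oU openT.
pose V := @chart R M i @` (@dom R M i `&` dom j); move=> k.
have fstk : Ck k (V `*` setT) (@fst (@model R M i) (@model R M i)).
  by apply: Ck_linear => // ?; apply: cvg_fst.
have VP (z : @model R M i * @model R M i) : (V `*` setT) z -> V z.1 by case.
exact: Ck_comp (open_setX oU openT) VP fstk (fk k).
Qed.

Lemma mdiff_tangent_proj (p : tangent M) : mdiff (@tangent_proj R M) p.
Proof.
exact: smooth_map_mdiff chart_retract_tangent smooth_map_tangent_proj.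
Qed.

(** In the chart [i] the projection is [fst] followed by the local representative of the identity,
    whose derivative is the identity. *)
Lemma chart_deriv_tangent_proj (p : tangent M) (i : idx M) u :
  dom i (projT1 p) ->
  chart_deriv (i : idx (tangent M)) i (@tangent_proj R M) p u = u.1.
Proof.
move=> ix.
pose y := chart (i : idx (tangent M)) p.
have di :
    is_diff (y.1) (local_rep i i (@id M)) ('d (local_rep i i (@id M)) (y.1)).
  exact: differentiableP (mdiff_id ix ix).1.
have c := is_diff_comp (is_diff_fst y) di.
rewrite -[RHS](chart_deriv_id u.1 ix).
exact: is_diffE c.
Qed.

Lemma tangent_map_comp (N K : charted R) (f : N -> M) (g : M -> K)
    (p : tangent N) : chart_retract N -> chart_retract K ->
  mdiff f (projT1 p) -> mdiff g (f (projT1 p)) ->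
  tangent_map (g \o f) p = tangent_map g (tangent_map f p).
Proof.
case: p => x v rN rK fx gx; rewrite /tangent_map /tangent_vector /=.
congr existT; apply: (chart_deriv_comp v rN rM fx gx) => //.
- exact: rN.1.
- exact: rM.1.
- exact: rK.1.
Qed.

Lemma tangent_mapE (N K : charted R) (f : N -> K) (p : tangent N) :
  tangent_map f p = tangent_vector
    (chart_deriv (chart_at (projT1 p)) (chart_at (f (projT1 p))) f (projT1 p)
      (projT2 p)).
Proof. by []. Qed.

Lemma tangent_map_id (p : tangent M) : tangent_map (@id M) p = p.
Proof.
case: p => x v; rewrite /tangent_map /tangent_vector /=; congr existT.
by apply: (chart_deriv_id v); exact: rM.1.
Qed.

Lemma chart_tangent_map (N : charted R) (f : N -> M) (x : N)
    (v : tangent_space x) (i : idx M) :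
  chart_retract N -> mdiff f x -> dom i (f x) ->
  chart (i : idx (tangent M)) (tangent_map f (tangent_vector v)) =
  (chart i (f x), chart_deriv (chart_at x) i f x v).
Proof.
move=> rN fx ix; rewrite [LHS]tangent_chart; congr pair.
by apply: chart_deriv_transition => //; [exact: rN.1|exact: rM.1].
Qed.

(** The equality of base points is proof-irrelevant, so the transport in the dependent pair is
    trivial. *)
Lemma tangent_vector_inj (x : M) : injective (@tangent_vector R M x).
Proof.
move=> v w vw; have := projT2_eq vw.
by rewrite (Prop_irrelevance (projT1_eq vw) erefl).
Qed.

End Tangent.

(** * A flow and a 1-form *)

Section FlowForm.
Context {R : realType} {M : charted R}.
Context (X : forall x : M, tangent_space x) (phi : R -> M -> M).
Context (alpha : forall x : M, {linear tangent_space x -> R^o}).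
Context (sM : smooth_atlas M) (hphi : global_flow X phi)
  (halpha : smooth_one_form alpha).

Let RI : charted R := normed_charted R^o.
Let RM : charted R := prod_charted RI M.
Let Phi : RM -> M := fun p => phi p.1 p.2.
Let ahat : tangent M -> RI := fun p => alpha (projT1 p) (projT2 p).
Let h : tangent M -> M := fun p => phi (ahat p) (projT1 p).

Let rM : chart_retract M := smooth_atlas_retract sM.
Let rI : chart_retract RI := chart_retract_normed R^o.
Let rRM : chart_retract RM := chart_retract_prod rI rM.
Let rTM : chart_retract (tangent M) := chart_retract_tangent sM.

(** * The flow: group law, smoothness and partial differentials *)

Lemma flow0 x : phi 0 x = x.
Proof. by case: hphi. Qed.

Lemma flowD s t x : phi (s + t) x = phi s (phi t x).
Proof. by case: hphi. Qed.

Lemma flow_inj t : injective (phi t).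
Proof.
by move=> x y e; rewrite -[x]flow0 -[y]flow0 -(addNr t) !flowD e.
Qed.

Lemma flow_eq s t x : phi s x = phi t x <-> phi (s - t) x = x.
Proof.
split=> [st|st]; last by rewrite -[in LHS](subrK t s) addrC flowD st.
by rewrite addrC flowD st -flowD addNr flow0.
Qed.

Lemma smooth_map_flow : smooth_map Phi.
Proof. by case: hphi. Qed.

Lemma mdiff_flow p : mdiff Phi p.
Proof. exact: smooth_map_mdiff rRM smooth_map_flow. Qed.

(** [h] is [Phi] after the pairing of [ahat] with the tangent projection. *)
Lemma smooth_map_algebra : smooth_map h.
Proof.
have s := smooth_map_pair rTM halpha (smooth_map_tangent_proj sM).
exact: (smooth_map_comp rTM rRM s smooth_map_flow).
Qed.

Lemma mdiff_form p : mdiff ahat p.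
Proof. exact: smooth_map_mdiff rTM halpha. Qed.

Let at_time (t : R) : M -> RM := fun x => (t : RI, x).
Let orbit (x : M) : RI -> RM := fun s => (s, x).

Lemma mdiff_at_time t x : mdiff (at_time t) x.
Proof. exact: mdiff_pair (@mdiff_cst _ _ _ _ _) (mdiff_id sM (x := x)). Qed.

Lemma mdiff_orbit x (s : RI) : mdiff (orbit x) s.
Proof. exact: mdiff_pair (@mdiff_id_normed _ _ _) (@mdiff_cst _ _ _ _ _). Qed.

Lemma mdiff_flow_time t x : mdiff (phi t) x.
Proof.
exact: (mdiff_comp rM rRM (@mdiff_at_time t x) (@mdiff_flow (t, x))).
Qed.

Lemma mdiff_flow_orbit x (s : RI) : mdiff (fun s : RI => phi s x) s.
Proof.
exact: (mdiff_comp rI rRM (@mdiff_orbit x s) (@mdiff_flow (s, x))).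
Qed.

(** [phi t] is [Phi] after [x |-> (t, x)], whose differential is [w |-> (0, w)]. *)
Lemma chart_deriv_flow_time (t : R) x (i j : idx M) w :
  dom i x -> dom j (phi t x) ->
  chart_deriv ((tt, i) : idx RM) j Phi (t, x) (0, w) =
  chart_deriv i j (phi t) x w.
Proof.
move=> ix jx.
have ti : dom ((tt, i) : idx RM) (at_time t x) by [].
rewrite [RHS](chart_deriv_comp w rM rRM (@mdiff_at_time t x)
  (@mdiff_flow (t, x)) ix ti jx).
congr (chart_deriv _ _ _ _ _); apply/esym.
rewrite (chart_deriv_pair w (@mdiff_cst _ _ _ _ _) (mdiff_id sM (x := x))) //.
by rewrite chart_deriv_cst chart_deriv_id.
Qed.

Lemma flow_velocity (t : R) x :
  chart_deriv (tt : idx RI) (chart_at (phi t x)) (fun s : RI => phi s x) t 1 =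
    X (phi t x).
Proof. have [_ _ _ hX] := hphi; exact: tangent_vector_inj (hX t x). Qed.

(** Orbits are integral curves of [X]; the derivative of [id] moves [X] from its preferred chart to
    [j]. *)
Lemma chart_deriv_flow_orbit (t : R) x (i j : idx M) (a : R^o) :
  dom i x -> dom j (phi t x) ->
  chart_deriv ((tt, i) : idx RM) j Phi (t, x) (a, 0) =
  a *: @chart_deriv _ M M (chart_at (phi t x)) j id (phi t x) (X (phi t x)).
Proof.
move=> ix jx.
have tj : dom j (Phi (orbit x t)) by [].
have ti : dom ((tt, i) : idx RM) (orbit x t) by [].
have E1 : chart_deriv (tt : idx RI) j (fun s : RI => phi s x) t a =
    chart_deriv ((tt, i) : idx RM) j Phi (t, x) (a, 0).
  rewrite (@chart_deriv_comp R RI RM M (orbit x) Phi t tt (tt, i) j a rI rRM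
    (@mdiff_orbit x t) (@mdiff_flow (t, x)) _ ti tj) //.
  congr (chart_deriv _ _ _ _ _).
  rewrite (@chart_deriv_pair R RI RI M id (fun=> x) t tt tt i a
    (@mdiff_id_normed _ _ _) (@mdiff_cst _ _ _ _ _)) //.
  by rewrite chart_deriv_cst chart_deriv_id_normed.
rewrite -E1 -flow_velocity (@chart_deriv_transition R M sM RI
  (fun s : RI => phi s x) t tt _ _ 1 rI (@mdiff_flow_orbit x t)) //;
  last exact: rM.1.
by rewrite -linearZ /= [_ *: 1]mulr1.
Qed.

Lemma tangent_map_flowD s t p :
  tangent_map (phi (s + t)) p = tangent_map (phi s) (tangent_map (phi t) p).
Proof.
have -> : phi (s + t) = phi s \o phi t by apply/funext => x; exact: flowD.
exact: (@tangent_map_comp R M sM M M (phi t) (phi s) p rM rM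
  (@mdiff_flow_time t (projT1 p)) (@mdiff_flow_time s (phi t (projT1 p)))).
Qed.

Lemma tangent_map_flow0 p : tangent_map (phi 0) p = p.
Proof.
have -> : phi 0 = id by apply/funext => x; exact: flow0.
exact: tangent_map_id.
Qed.

(** * The pulled-back form and the algebra identity *)

(** This is [phi_t^* alpha], as a function on the tangent bundle. *)
Definition pullback (t : R) (p : tangent M) : R := ahat (tangent_map (phi t) p).

Lemma pullbackD s t p : pullback (s + t) p = pullback s (tangent_map (phi t) p).
Proof. by rewrite /pullback tangent_map_flowD. Qed.

Lemma pullback0 p : pullback 0 p = ahat p.
Proof. by rewrite /pullback tangent_map_flow0. Qed.

Lemma pullbackZ t (x : M) a (w : tangent_space x) :
  pullback t (tangent_vector (a *: w)) = a * pullback t (tangent_vector w).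
Proof. by rewrite /pullback /ahat /= !linearZ. Qed.

Let fX (x : M) : R := alpha x (X x).

(** The differential along [xi] of [alpha] viewed as a function on the tangent bundle, not its
    exterior derivative. *)
Definition form_speed (xi : tangent (tangent M)) : R :=
  chart_deriv (chart_at (projT1 (projT1 xi)) : idx (tangent M)) (tt : idx RI)
    ahat (projT1 xi) (projT2 xi).

(** Chain rule for [h] as [Phi] after [k]. The differential of [k] sends [xi] to [(a, u.1)], whose
    time and space parts bring in the two partial differentials of the flow. *)
Lemma tangent_map_algebra (xi : tangent (tangent M)) :
  let x := projT1 (projT1 xi) in let t := ahat (projT1 xi) in
  let a := form_speed xi in
  tangent_map h xi = tangent_vector (a *: X (phi t x) +
    projT2 (tangent_map (phi t) (@tangent_vector R M x (projT2 xi).1))).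
Proof.
move=> x t a; rewrite [LHS]tangent_mapE.
pose p := projT1 xi; pose u := projT2 xi.
apply: (congr1 (@tangent_vector R M (phi t x))).
pose k (q : tangent M) : RM := (ahat q : RI, projT1 q).
have pk : mdiff k p.
  exact: mdiff_pair (@mdiff_form p) (@mdiff_tangent_proj R M sM p).
have cx : dom (chart_at x) x by exact: rM.1.
have cy : dom (chart_at (phi t x)) (phi t x) by exact: rM.1.
have tk : dom ((tt, chart_at x) : idx RM) (k p) by [].
have Ek : chart_deriv (chart_at x : idx (tangent M))
    ((tt, chart_at x) : idx RM) k p u = (a, u.1).
  rewrite (@chart_deriv_pair R (tangent M) RI M ahat (@tangent_proj R M) p
    (chart_at x) tt (chart_at x) u (@mdiff_form p)
    (@mdiff_tangent_proj R M sM p)) //.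
  by rewrite chart_deriv_tangent_proj.
have Ec := @chart_deriv_comp R (tangent M) RM M k Phi p (chart_at x)
  (tt, chart_at x)
  (chart_at (phi t x)) u rTM rRM pk (@mdiff_flow (k p)) cx tk cy.
refine (etrans Ec _).
refine (etrans (congr1 (chart_deriv ((tt, chart_at x) : idx RM)
  (chart_at (phi t x)) Phi (k p)) Ek) _).
have -> : (a, u.1) = (a, 0) + (0, u.1) :> @model R RM (tt, chart_at x).
  by congr pair; rewrite ?addr0 ?add0r.
rewrite /chart_deriv linearD -!/(chart_deriv _ _ _ _ _).
congr (_ + _); last exact: chart_deriv_flow_time.
by rewrite chart_deriv_flow_orbit // chart_deriv_id.
Qed.

Lemma form_tangent_map_algebra (xi : tangent (tangent M)) :
  let x := projT1 (projT1 xi) in let t := ahat (projT1 xi) in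
  let a := form_speed xi in
  ahat (tangent_map h xi) = a * fX (phi t x) +
    pullback t (@tangent_vector R M x (projT2 xi).1).
Proof.
move=> x t a; rewrite tangent_map_algebra -/x -/t -/a /pullback /ahat /=.
by rewrite linearD linearZ.
Qed.

Lemma tangent_multE (xi : tangent (tangent M)) :
  tangent_mult xi = @tangent_vector R M (projT1 (projT1 xi))
    (projT2 (projT1 xi) + (projT2 xi).1).
Proof.
case: xi => -[x v] u; rewrite /tangent_mult /tangent_vector /=.
congr existT; congr (_ + _).
exact: (@chart_deriv_tangent_proj R M sM (tangent_vector v) (chart_at x) u
  (rM.1 x)).
Qed.

(** Both sides lie on the orbit of [x], at the times [b + t] and [t + q], so they agree exactly when
    the flow at time [b - q] fixes [x]. *)
Lemma algebra_identity (xi : tangent (tangent M)) :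
  let x := projT1 (projT1 xi) in let t := ahat (projT1 xi) in
  let a := form_speed xi in
  h (tangent_map h xi) = h (tangent_mult xi) <->
  phi (a * fX (phi t x) + pullback t (@tangent_vector R M x (projT2 xi).1)
       - alpha x (projT2 xi).1) x = x.
Proof.
move=> x t a; rewrite {1}/h form_tangent_map_algebra -/x -/t -/a.
rewrite tangent_multE /h /ahat /= linearD /= -/x -/(ahat _) -/t.
set b := _ + pullback _ _; set q := alpha x _.
rewrite -flowD flow_eq.
by have -> : b + t - (t + q) = b - q by rewrite [t + q]addrC opprD addrACA
  subrr addr0.
Qed.

(** * Vertical derivatives and Cartan's formula on the manifold *)

Lemma chart_deriv_form_vertical (x : M) (v q : tangent_space x) :
  chart_deriv (chart_at x : idx (tangent M)) (tt : idx RI) ahat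
    (tangent_vector v) (0, q) = alpha x q.
Proof.
set c := chart_at x; pose A := local_rep (c : idx (tangent M)) (tt : idx RI)
  ahat.
have vE u : chart (c : idx (tangent M)) (@tangent_vector R M x u) =
    (chart c x, u).
  exact: tangent_chart_at.
have dA u : differentiable A (chart c x, u).
  by rewrite -vE; apply: (mdiff_form (p := tangent_vector u) _ _).1 => //;
    exact: rM.1.
have lA : linear (fun u => A (chart c x, u)).
  by move=> a u w; rewrite /A /local_rep /= /ahat /= !linearP.
have := is_diff_fibre_linear v q dA lA.
rewrite /chart_deriv vE => ->.
by rewrite /A /local_rep -vE rTM.2 //; exact: rM.1.
Qed.

Lemma flow_orbit_near (x : M) (i : idx M) : dom i x ->
  \forall s \near (0 : R), dom i (phi s x).
Proof.
move=> ix; have ix0 : dom i (phi 0 x) by rewrite flow0.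
by have [_] := @mdiff_flow_orbit x (0 : R) tt i Logic.I ix0.
Qed.

(** The derivative at 0 is [L_X alpha], in which the term [d(alpha(X))] vanishes. The proof checks
    the hypotheses of [local_cartan] in the preferred chart at [x]. *)
Lemma cartan (x : M) (w : tangent_space x) : semibasic alpha X ->
  is_derive (0 : R) 1 (fun s : R => pullback s (tangent_vector w))
    (ext_deriv alpha (X x) w).
Proof.
move=> sX; set c := chart_at x; set y := chart c x.
have cx : dom c x by exact: rM.1.
pose P := local_rep ((tt, c) : idx RM) c Phi.
pose A := local_rep (c : idx (tangent M)) (tt : idx RI) ahat.
have vE u : chart (c : idx (tangent M)) (@tangent_vector R M x u) = (y, u).
  exact: tangent_chart_at.
have dA u : differentiable A (y, u).
  by rewrite -vE; apply: (mdiff_form (p := tangent_vector u) _ _).1.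
have lA : linear (fun u => A (y, u)).
  by move=> a u v; rewrite /A /local_rep /= /ahat /= !linearP.
have AE (p : tangent M) : dom c (projT1 p) ->
    A (chart (c : idx (tangent M)) p) = ahat p.
  by move=> cp; rewrite /A /local_rep rTM.2.
have [oU kU] := smooth_map_flow ((tt, c) : idx RM) c.
set U := _ @` _ in oU kU.
have Uy : U (0, y) by exists (0, x) => //; split => //=; rewrite /Phi /= flow0.
(* [local_cartan] takes the field to be the time derivative of the flow at 0; this identifies it
   with [X]. *)
have DX z : dom c z -> 'd P (0, chart c z) (1, 0) =
    @chart_deriv _ M M (chart_at z) c id z (X z).
  move=> cz; have c0 : dom c (phi 0 z) by rewrite flow0.
  have := chart_deriv_flow_orbit 1 cz c0; rewrite scale1r.
  by rewrite flow0.
have near_dom : \forall z \near y, exists2 x', dom c x' & chart c x' = z.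
  have [oV _] := smooth_map_id sM c c.
  have Vy : (chart c @` (@dom R M c `&` dom c)) y by exists x.
  by apply: filterS (open_nbhs_nbhs (conj oV Vy)) => _ [x' [cx' _] <-];
    exists x'.
have P0 : \forall z \near y, P (0, z) = z.
  apply: filterS near_dom => _ [x' cx' <-].
  by rewrite /P /local_rep /Phi /= rM.2 // flow0.
have A0 : \forall z \near y, A (z, 'd P (0, z) (1, 0)) = 0.
  apply: filterS near_dom => _ [x' cx' <-].
  by rewrite DX //; exact: etrans (AE (tangent_vector (X x')) cx') (sX x').
have L := local_cartan w oU Uy (kU 2%N) dA lA P0 A0.
have X0 : 'd P (0, y) (1, 0) = X x by rewrite DX // chart_deriv_id.
(* The derivatives with frozen vectors in [ext_deriv] are those of [A] in base directions. *)
have Ad u v : 'd (fun z => local_form alpha z u) y v = 'd A (y, u) (v, 0).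
  have i : is_diff y (fun z => (z, u)) (fun v => (v, 0)).
    exact: is_diff_pair (is_diff_id y) (is_diff_cst u y).
  exact: is_diffE (is_diff_comp i (differentiableP (dA u))).
rewrite /ext_deriv -/c -/y !Ad -X0.
apply: near_eq_is_derive L.
(* For small [s] the orbit stays in [dom c], where the chart expression is the pullback. *)
apply: filterS (flow_orbit_near cx) => s cs.
have Ps : P (s, y) = chart c (phi s x) by rewrite /P /local_rep /Phi /= rM.2.
have E := etrans (f_equal2 pair Ps (chart_deriv_flow_time w cx cs))
  (esym (chart_tangent_map sM w rM (@mdiff_flow_time s x) cs)).
exact: etrans (congr1 A E) (AE (tangent_map (phi s) (tangent_vector w)) cs).
Qed.

Lemma fixed_point_field (x : M) : (forall t, phi t x = x) -> X x = 0.
Proof.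
move=> fx; have X0 : X (phi 0 x) = 0.
  rewrite -flow_velocity.
  have -> : (fun s : RI => phi s x) = fun=> x by apply/funext => s; exact: fx.
  exact: chart_deriv_cst.
by move: X0; rewrite flow0.
Qed.

Lemma ext_deriv0 (x : M) (w : tangent_space x) :
  ext_deriv alpha (0 : tangent_space x) w = 0.
Proof.
rewrite /ext_deriv linear0 sub0r.
have -> : (fun y => local_form alpha y (0 : tangent_space x)) = cst 0.
  by apply/funext => y; rewrite /local_form /= !linear0.
by rewrite (is_diffE w (is_diff_cst _ _)) oppr0.
Qed.

(** * The two implications *)

Lemma basic_algebra : basic alpha X -> tangent_algebra h.
Proof.
move=> [sX dX].
(* By the flow law, the derivative of the pullback at time [t] on [p] is its derivative at time 0 on
   the transported vector, where Cartan's formula gives 0. *)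
have pb t p : pullback t p = ahat p.
  rewrite -(pullback0 p).
  apply: (is_derive_0_is_cst (f := fun t => pullback t p)) => {}t.
  case: (tangent_map (phi t) p) (fun s => pullbackD s t p) => x w pE.
  apply: is_derive_translate pE _.
  by rewrite -[X in is_derive _ _ _ X](dX x w); exact: cartan.
split; first exact: smooth_map_algebra.
  by move=> x; rewrite /h /ahat /= linear0 flow0.
move=> xi; apply/algebra_identity.
by rewrite /fX sX mulr0 add0r pb /ahat /= subrr flow0.
Qed.

Lemma algebra_basic : tangent_algebra h -> basic alpha X.
Proof.
move=> [_ _ hA].
pose fixed x := forall t, phi t x = x.
(* The multiples [s * c] of a nonzero [c] exhaust all times. *)
have scaled x (c : R) : (forall s, phi (s * c) x = x) -> c != 0 -> fixed x.
  by move=> H c0 t; rewrite -(divfK c0 t).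
(* The identity at the vector over [(x, v)] with horizontal part [u1] and vertical part [u2]. *)
have key x (v u1 u2 : tangent_space x) :
    let t := alpha x v in
    let xi : tangent (tangent M) := @tangent_vector R (tangent M)
      (tangent_vector v) (u1, u2) in
    phi (form_speed xi * fX (phi t x) + pullback t (tangent_vector u1)
      - alpha x u1) x = x.
  exact: (algebra_identity _).1 (hA _).
(* With [v = u1 = 0] and [u2 = s X] the time is [s alpha(X)^2]. If [alpha(X)] were nonzero, [x]
   would be fixed, so [X] would vanish there, and [alpha(X)] with it. *)
have sX : semibasic alpha X.
  move=> x; apply/eqP/negPn/negP => c0.
  have c20 : alpha x (X x) * alpha x (X x) != 0 by rewrite mulf_neq0.
  have X0 : X x = 0.
    apply/fixed_point_field/(scaled _ _ _ c20) => s.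
    have := key x 0 0 (s *: X x); have a0 : alpha x 0 = 0 := linear0 _.
    rewrite /= a0 pullback0 [ahat _]a0 flow0 addr0 subr0.
    by rewrite /form_speed chart_deriv_form_vertical linearZ mulrA.
  by move: c0; rewrite X0 linear0 eqxx.
(* Horizontal vectors [s w] make the time [s] times the difference of the two sides; only the values
   [t] of [alpha x] are reached. *)
have inv x (t : R) (w : tangent_space x) :
    ~ fixed x -> (exists v, alpha x v = t) ->
    pullback t (tangent_vector w) = alpha x w.
  move=> nfx [v vt]; apply/eqP; rewrite -subr_eq0; apply/negPn/negP => c0.
  apply/nfx/(scaled _ _ _ c0) => s.
  have := key x v (s *: w) 0; rewrite /= vt /fX sX mulr0 add0r.
  by rewrite pullbackZ linearZ mulrBr.
have surj x :
    (forall v, alpha x v = 0) \/ (forall t : R, exists v, alpha x v = t).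
  have [[v v0]|n0] := pselect (exists v, alpha x v != 0); last first.
    by left => v; apply/eqP/negPn/negP => v0; apply: n0; exists v.
  right=> t; exists ((t / alpha x v) *: v).
  by rewrite linearZ /= -[_ *: _]/(_ * _) divfK.
have nfixed x t : ~ fixed x -> ~ fixed (phi t x).
  by move=> nf f; apply: nf => s; have := f s;
    rewrite -flowD addrC flowD => /flow_inj.
have pb x t (w : tangent_space x) : ~ fixed x ->
    pullback t (tangent_vector w) = alpha x w.
  (* If [alpha] vanishes at [x] but not at [phi t x], the time [- t] is reached from [phi t x].
     Flowing back then equates the pullback at time [t] with [alpha x w], which is 0. *)
  move=> nfx; have [a0|a] := surj x; last exact: inv.
  rewrite a0; have [b0|b] := surj (phi t x).
    exact: b0.
  have E : pullback (- t) (tangent_map (phi t) (tangent_vector w)) =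
      pullback t (tangent_vector w).
    exact: (inv _ (- t) (projT2 (tangent_map (phi t) (tangent_vector w)))
      (nfixed _ t nfx) (b _)).
  by rewrite -E -pullbackD addNr pullback0; exact: a0.
split => // x w.
(* At a fixed point [X] vanishes. Elsewhere the pullback is constant in time, and its derivative at
   0 is the contraction of [X] with the exterior derivative. *)
have [fx|nfx] := pselect (fixed x).
  by rewrite fixed_point_field // ext_deriv0.
have [_ <-] := cartan w sX.
have -> : (fun s : R => pullback s (tangent_vector w)) = cst (alpha x w).
  by apply/funext => s; exact: pb.
exact: derive_cst.
Qed.

End FlowForm.

Unset Implicit Arguments.

Theorem proposition5p1p3 (R : realType) (M : charted R)
    (X : forall x : M, tangent_space x) (phi : R -> M -> M)
    (alpha : forall x : M, {linear tangent_space x -> R^o})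
    (hM : manifold M)
    (hX : smooth_vector_field X)
    (hphi : global_flow X phi)
    (halpha : smooth_one_form alpha) :
  tangent_algebra
    (fun p : tangent M => phi (alpha (projT1 p) (projT2 p)) (projT1 p))
  <-> basic alpha X.
Proof.
have [sM _ _ _] := hM.
split; first exact: algebra_basic sM hphi halpha.
exact: basic_algebra sM hphi halpha.
Qed.
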